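(* Let $w=(w(i),i\ge1)$ be a sequence of nonnegative real numbers and let $c>0$. For every $i\ge0$, set $w^{\mathsf{o}}(i)=w(i+1)$ and $w^{\mathsf{e}}(i)=c^{-(i+1)}$. Then, for every $n\ge1$ such that $\sum_{Q\in\mathbb{NC}_n}\Omega^w(Q)>0$ and every $P\in\mathbb{NC}_n$, $$\mathbb{P}^w_n(P)=\mathbb{Q}^{(w^{\mathsf{e}},w^{\mathsf{o}})}_{n+1}(T^\circ(P)).$$
   Context: Non-crossing partitions. A partition of $[n]=\{1,\dots,n\}$ is non-crossing if, when $1,\dots,n$ are placed in clockwise order at the vertices of a regular $n$-gon, the convex hulls of its blocks are pairwise disjoint; $\mathbb{NC}_n$ is the set of non-crossing partitions of $[n]$. For $P\in\mathbb{NC}_n$, $\Omega^w(P)=\prod_{B\text{ block of }P}w(|B|)$ and $\mathbb{P}^w_n(P)=\Omega^w(P)/\sum_{Q\in\mathbb{NC}_n}\Omega^w(Q)$. Two-type trees. Plane trees are finite rooted trees with ordered children; $k_u$ denotes the number of children of $u$. $\mathbb{T}^{(\mathsf{e},\mathsf{o})}_m$ is the set of plane trees with $m$ vertices regarded as two-type trees, where $\mathsf{e}(\tau)$ and $\mathsf{o}(\tau)$ denote the sets of vertices of $\tau$ at even and odd generation respectively. For weight sequences $w^{\mathsf{e}},w^{\mathsf{o}}$ (indexed by $i\ge0$), $\Omega^{(w^{\mathsf{e}},w^{\mathsf{o}})}(\tau)=\prod_{u\in\mathsf{e}(\tau)}w^{\mathsf{e}}(k_u)\prod_{u\in\mathsf{o}(\tau)}w^{\mathsf{o}}(k_u)$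 and $\mathbb{Q}^{(w^{\mathsf{e}},w^{\mathsf{o}})}_m(\tau)=\Omega^{(w^{\mathsf{e}},w^{\mathsf{o}})}(\tau)/\sum_{T\in\mathbb{T}^{(\mathsf{e},\mathsf{o})}_m}\Omega^{(w^{\mathsf{e}},w^{\mathsf{o}})}(T)$ (when the denominator is positive). Dual tree. Draw $P$ with $l\in[n]$ at $e^{-2\mathrm{i}\pi l/n}$ and each block as its polygon (singletons being viewed as self-loops and blocks of size two as double edges). Put a black vertex inside each block and a white vertex inside each other face of the disk, and join two vertices if the corresponding faces share a common edge (equivalently: for each $l\in[n]$ there is one edge joining the block containing $l$ to the white face whose boundary contains the arc of circle going clockwise from $l$ to $l+1$, where $n+1$ means $1$). This gives a planar bipartite tree $T(P)$ with $n+1$ vertices. $T^\circ(P)$ is the plane tree obtained by rooting $T(P)$ at the white vertex of the face containing the vertices $1$ and $n$ (the face adjacent to the arc from $n$ to $1$), so that its first child is the block containing $1$; children are listed in clockwise order (starting from the root corner for the root, from the edge to the parent for other vertices). *)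

(* Defs.v *)
From HB Require Import structures.
From mathcomp Require Import all_boot all_order all_algebra.
From mathcomp Require Import boolp classical_sets cardinality fsbigop reals.
From mathcomp Require Import topology normedtype trigo.

Set Implicit Arguments.
Unset Strict Implicit.
Unset Printing Implicit Defensive.

Import Order.TTheory GRing.Theory Num.Theory.
Import numFieldNormedType.Exports.

Local Open Scope ring_scope.

(** * Non-crossing partitions

    The label [l] of {1, ..., n} is the ordinal [i : 'I_n] with [l = i.+1];
    a partition of {1, ..., n} is [P : {set {set 'I_n}}] such that
    [finset.partition P setT]. *)

Notation plane R := (R^o * R^o)%type.

(* exp(- 2 i pi x / n); increasing x runs clockwise. *)
Definition circle_pt (R : realType) (n : nat) (x : R) : plane R :=
  (cos (2 * pi * x / n%:R), - sin (2 * pi * x / n%:R)).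

Definition vertex (R : realType) (n : nat) (i : 'I_n) : plane R :=
  circle_pt n i.+1%:R.

Definition hull (R : realType) (n : nat) (B : {set 'I_n}) : set (plane R) :=
  [set x | exists a : 'I_n -> R,
     [/\ forall i, i \in B -> 0 <= a i,
         \sum_(i in B) a i = 1 &
         x = \sum_(i in B) a i *: vertex R i]]%classic.
Arguments hull R {n} B _.

Definition noncrossing (R : realType) (n : nat) : {set {set {set 'I_n}}} :=
  [set P : {set {set 'I_n}} | finset.partition P finset.setT &
     `[< forall B C, B \in P -> C \in P -> B != C ->
           (hull R B `&` hull R C = set0)%classic >]].

Definition weight_nc (R : realType) (w : nat -> R) (n : nat)
    (P : {set {set 'I_n}}) : R :=
  \prod_(B in P) w #|B|.

Definition partition_fun_nc (R : realType) (w : nat -> R) (n : nat) : R :=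
  \sum_(Q in noncrossing R n) weight_nc w Q.

Definition prob_nc (R : realType) (w : nat -> R) (n : nat)
    (P : {set {set 'I_n}}) : R :=
  weight_nc w P / partition_fun_nc w n.

(** * Plane trees, seen as two-type trees *)

Inductive ptree := PNode of seq ptree.

Definition children (t : ptree) : seq ptree := let: PNode ts := t in ts.

Fixpoint ptree_enc (t : ptree) : GenTree.tree unit :=
  let: PNode ts := t in GenTree.Node 0 (map ptree_enc ts).

Fixpoint ptree_dec (t : GenTree.tree unit) : ptree :=
  if t is GenTree.Node _ ts then PNode (map ptree_dec ts) else PNode [::].

Lemma ptree_encK : cancel ptree_enc ptree_dec.
Proof.
rewrite /cancel; fix IH 1 => -[ts] /=; congr PNode.
by elim: ts => [|t ts IHts] //=; rewrite IH IHts.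
Qed.

HB.instance Definition _ := Countable.copy ptree (can_type ptree_encK).

(* Ulam-Harris coding: a vertex is the word of the ranks (from 0) of its
   ancestors among their siblings, so that its generation is its length. *)
Fixpoint vertices (t : ptree) : seq (seq nat) :=
  let: PNode ts := t in
  [::] :: (fix forest (i : nat) (ts : seq ptree) : seq (seq nat) :=
             if ts is t' :: ts' then
               map (cons i) (vertices t') ++ forest i.+1 ts'
             else [::]) 0%N ts.

(* The number k_u of children of the vertex u of t. *)
Fixpoint nb_children (t : ptree) (u : seq nat) : nat :=
  if u is i :: u' then nb_children (nth (PNode [::]) (children t) i) u'
  else size (children t).

Definition trees (m : nat) : set ptree :=
  [set t | size (vertices t) = m]%classic.

Definition weight_tree (R : realType) (we wo : nat -> R) (t : ptree) : R :=
  (\prod_(u <- vertices t | ~~ odd (size u)) we (nb_children t u)) *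
  (\prod_(u <- vertices t | odd (size u)) wo (nb_children t u)).

(* A finitely supported sum, hence a genuine one: [trees m] is finite. *)
Definition partition_fun_tree (R : realType) (we wo : nat -> R) (m : nat) : R :=
  \sum_(t \in trees m) weight_tree we wo t.

Definition prob_tree (R : realType) (we wo : nat -> R) (m : nat) (t : ptree) : R :=
  weight_tree we wo t / partition_fun_tree we wo m.

(** * The dual tree *)

(* The white faces are the connected components of the closed disk deprived of
   the convex hulls of the blocks.  Removing the inside of a self-loop or of a
   double edge instead of a point or of a segment does not change how the arcs
   of the circle are distributed among the faces. *)
Definition white_region (R : realType) (n : nat) (P : {set {set 'I_n}}) :
    set (plane R) :=
  [set x : plane R | x.1 ^+ 2 + x.2 ^+ 2 <= 1 /\
     forall B, B \in P -> ~ hull R B x]%classic.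
Arguments white_region R {n} P _.

(* The white face containing the open arc from the label l to the label l + 1,
   given by the midpoint of that arc. *)
Definition white_face (R : realType) (n : nat) (P : {set {set 'I_n}}) (l : nat) :
    set (plane R) :=
  connected_component (white_region R P) (circle_pt n (l%:R + 2^-1)).
Arguments white_face R {n} P l _.

(* T(P) has one edge per label, joining the black vertex [pblock P i] to the
   white vertex [white_face R P i.+1].  The edges around a vertex, black or
   white, are in clockwise order when their labels are in (cyclic) increasing
   order.  A vertex is thus given by one of its edges together with a colour,
   [black : bool]. *)
Definition share_end (R : realType) (n : nat) (P : {set {set 'I_n}})
    (black : bool) (i j : 'I_n) : bool :=
  if black then finset.pblock P i == finset.pblock P j
  else `[< white_face R P i.+1 = white_face R P j.+1 >].

(* i + 1, ..., n - 1, 0, ..., i - 1 *)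
Definition clockwise_after (n : nat) (i : 'I_n) : seq 'I_n :=
  behead (rot i (enum 'I_n)).

(* The subtree hanging from the end of colour [black] of the edge i, when i
   joins this end to its parent, cut [h] generations below that end. *)
Fixpoint dual_subtree (R : realType) (n : nat) (P : {set {set 'I_n}})
    (h : nat) (black : bool) (i : 'I_n) : ptree :=
  if h is h'.+1 then
    PNode [seq dual_subtree R P h' (~~ black) j
             | j <- clockwise_after i & share_end R P black i j]
  else PNode [::].

(* The root is the white face of the arc from n to 1, and its corner lies
   between the edges of labels n and 1.  As T(P) has n edges, its height is at
   most n, so that nothing is lost by the cut. *)
Definition dual_tree (R : realType) (n : nat) (P : {set {set 'I_n}}) : ptree :=
  PNode [seq dual_subtree R P n true j
           | j : 'I_n <- enum 'I_n & `[< white_face R P j.+1 = white_face R P n >]].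

(* Main.v *)
Require Import Defs.
From mathcomp Require Import all_boot all_order all_algebra.
From mathcomp Require Import reals.
From mathcomp Require Import boolp classical_sets fsbigop topology normedtype trigo.
From mathcomp Require Import zify ring lra.

(** The dual tree is a weight-preserving bijection from the non-crossing
    partitions of [n] onto the plane trees with n + 1 vertices, up to the
    constant factor c^-(n+1): the black vertices are the blocks, a block of size
    k has k - 1 children, and the exponents k_u + 1 of the white vertices u add
    up to the total number of vertices, every black vertex being the child of a
    white one.

    The geometry reduces to the sign of the area of a triangle inscribed in the
    circle, which is given by the cyclic order of its vertices.  The chord
    between two arc midpoints stays in the white region when every block lies on
    one side of it; conversely a block with a label on each side contains a chord
    which separates the two midpoints.

    Combinatorially, the labels below a white vertex form an interval which is a
    union of blocks; it is cut into the shortest such intervals starting at its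
    left end, one for each black child.  In each of them, the first block spans
    the whole interval and the gaps between its consecutive labels are the
    intervals of the white children.  This recursion can be read in both
    directions. *)

Set Implicit Arguments.
Unset Strict Implicit.
Unset Printing Implicit Defensive.

Import Order.TTheory GRing.Theory Num.Theory.
Import numFieldNormedType.Exports.

Local Open Scope ring_scope.

(** * Partitions of an interval and forests *)

Section Matching.
Local Open Scope nat_scope.
(* A partition is given by labels: [x] and [y] are in the same block when
   [f x = f y]. *)
Variables (T : eqType) (f : nat -> T).

(* [wmatch a ts b]: below a white vertex with children [ts] lies the restriction
   of the partition to the interval from [a] to [b - 1].
   [bmatch x ss m]: [x] and [m] are in the same block, and the black vertex of
   this block, with the children [ss] only, describes the interval from [x] to
   [m], ends included. *)
Inductive wmatch : nat -> seq ptree -> nat -> Prop :=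
| wmatch_nil a : wmatch a [::] a
| wmatch_cons a m b ss ts of
    bmatch a ss m & wmatch m.+1 ts b &
    (forall u v, a <= u <= m -> m < v < b -> f u <> f v) :
    wmatch a (PNode ss :: ts) b
with bmatch : nat -> seq ptree -> nat -> Prop :=
| bmatch_nil m : bmatch m [::] m
| bmatch_cons x y m ts ss of
    wmatch x.+1 ts y & f x = f y & bmatch y ss m &
    (forall u v, x < u < y -> y <= v <= m -> f u <> f v) :
    bmatch x (PNode ts :: ss) m.

Definition crossing_free (a b : nat) : Prop :=
  forall p q r s, a <= p -> p < q -> q < r -> r < s -> s < b ->
    f p = f r -> f q = f s -> f p = f q.

(* The interval from [a] to [b - 1] is a union of blocks of the partition of
   {0, ..., n - 1}. *)
Definition closed_in (n a b : nat) : Prop :=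
  forall u v, u < n -> v < n -> f u = f v -> (a <= u < b) = (a <= v < b).

End Matching.

Scheme wmatch_mut := Induction for wmatch Sort Prop
  with bmatch_mut := Induction for bmatch Sort Prop.
Combined Scheme match_ind from wmatch_mut, bmatch_mut.

(** The first tree is split off, with hypotheses both on its children and on the remaining trees,
    which is the shape of the mutual predicates [wmatch] and [bmatch]. *)
Lemma forest_ind (P : seq ptree -> Prop) :
  P [::] -> (forall ss ts, P ss -> P ts -> P (PNode ss :: ts)) ->
  forall ts, P ts.
Proof.
move=> P0 PS.
have Pt : forall t, P (children t).
  by fix IH 1 => -[ts] /=; elim: ts => // t ts IHts; move: (IH t); case: t => ss /PS; apply.
by elim=> // -[ss] ts; apply/PS/(Pt (PNode ss)).
Qed.

Section MatchingTheory.
Local Open Scope nat_scope.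
Variables (T : eqType) (f : nat -> T).

Lemma match_bounds :
  (forall a ts b, wmatch f a ts b -> a <= b) /\
  (forall x ss m, bmatch f x ss m -> x <= m /\ f x = f m).
Proof.
by apply: match_ind => //= *; intuition lia || (intuition congruence).
Qed.

Lemma wmatch_le a ts b : wmatch f a ts b -> a <= b.
Proof. by case: match_bounds => H _ /H. Qed.

Lemma bmatch_le x ss m : bmatch f x ss m -> x <= m.
Proof. by case: match_bounds => _ H /H[]. Qed.

Lemma bmatch_eq x ss m : bmatch f x ss m -> f x = f m.
Proof. by case: match_bounds => _ H /H[]. Qed.

Lemma wmatch_consE a ss ts b : wmatch f a (PNode ss :: ts) b ->
  exists m, [/\ bmatch f a ss m, wmatch f m.+1 ts b &
    forall u v, a <= u <= m -> m < v < b -> f u <> f v].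
Proof. by move=> H; inversion H; subst; eexists; split; eassumption. Qed.

Lemma bmatch_consE x ts ss m : bmatch f x (PNode ts :: ss) m ->
  exists y, [/\ wmatch f x.+1 ts y, f x = f y, bmatch f y ss m &
    forall u v, x < u < y -> y <= v <= m -> f u <> f v].
Proof. by move=> H; inversion H; subst; eexists; split; eassumption. Qed.

(** By the separation conditions a crossing would lie within a single piece. In a black step it may
    also involve [x], which is then replaced by [y], of the same block. *)
Lemma match_crossing_free :
  (forall a ts b, wmatch f a ts b -> crossing_free f a b) /\
  (forall x ss m, bmatch f x ss m -> crossing_free f x m.+1).
Proof.
apply: match_ind.
- by move=> a p q r s; lia.
- move=> a m b ss ts _ IHb _ IHw sep p q r s ap pq qr rs sb fpr fqs.
  have [sm|ms] := leqP s m; first exact: (IHb p q r s).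
  have [qm|mq] := leqP q m; first by case: (sep q s); rewrite ?fqs //; lia.
  have [pm|mp] := leqP p m; first by case: (sep p r); rewrite ?fpr //; lia.
  exact: (IHw p q r s).
- by move=> m p q r s; lia.
- move=> x y m ts ss _ IHw fxy Hb IHb sep p q r s xp pq qr rs sm fpr fqs.
  have sep' u v : x < u < y -> x <= v <= m -> f u = f v -> x < v < y.
    move=> Hu Hv fuv; have [/eqP vx|vx] := boolP (v == x).
      by case: (sep u y Hu); rewrite -?fxy -?vx //; have := bmatch_le Hb; lia.
    by have [//|yv] := ltnP v y; [lia | case: (sep u v Hu) => //; lia].
  have [qy|yq] := ltnP q y.
    have sy : x < s < y by apply: (sep' q); rewrite -?fqs //; lia.
    have ry : x < r < y by lia.
    have /andP[xp' _] : x < p < y by apply: (sep' r) => //; lia.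
    by apply: (IHw p q r s) => //; lia.
  have [yp|py] := leqP y p; first exact: (IHb p q r s).
  have [xp'|px] := ltnP x p.
    by have : x < r < y by [apply: (sep' p) => //; lia]; lia.
  have ?: p = x by lia.
  subst p; have [/eqP ->|qny] := boolP (q == y); first by rewrite fxy.
  by rewrite fxy; apply: (IHb y q r s) => //; [lia | rewrite -fxy].
Qed.

Lemma crossing_free_sub a b a' b' :
  a <= a' -> b' <= b -> crossing_free f a b -> crossing_free f a' b'.
Proof. by move=> aa bb nc p q r s *; apply: (nc p q r s) => //; lia. Qed.

(** Greedy choice: a white step takes the last label of the block of [a], a black step the next
    label of the block of [x]. The white step may call the black one on the whole interval, so [Hb]
    is proved first for the same [k]. *)
Lemma crossing_free_match k :
  (forall a b, a <= b -> b - a <= k -> crossing_free f a b ->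
     exists ts, wmatch f a ts b) /\
  (forall x m, x <= m -> m - x < k -> f x = f m -> crossing_free f x m.+1 ->
     exists ss, bmatch f x ss m).
Proof.
elim/ltn_ind: k => k IH.
have Hb x m : x <= m -> m - x < k -> f x = f m -> crossing_free f x m.+1 ->
     exists ss, bmatch f x ss m.
  move=> xm mxk fxm nc; have [/eqP <-|xNm] := boolP (x == m).
    by exists [::]; constructor.
  have ex_y : exists y, (f x == f y) && (x < y) by exists m; rewrite fxm eqxx /=; lia.
  case: (ex_minnP ex_y) => y /andP[/eqP fxy xy] ymin.
  have ym : y <= m by apply: ymin; rewrite fxm eqxx; lia.
  have [|||ts Hts] := (IH (m - x) mxk).1 x.+1 y; [lia|lia| |].
    by apply: crossing_free_sub nc; lia.
  have [||||ss Hss] := (IH (m - x) mxk).2 y m; [lia|lia|congruence| |].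
    by apply: crossing_free_sub nc; lia.
  exists (PNode ts :: ss); apply: (bmatch_cons Hts) => // u v /andP[xu uy] /andP[yv vm] fuv.
  suff fxu : f x = f u by have := ymin u; rewrite fxu eqxx xu /=; lia.
  have [vy|yv'] := boolP (v == y); first by rewrite fxy fuv (eqP vy).
  by apply: (nc x u y v) => //; lia.
split=> // a b ab bak nc; have [/eqP <-|aNb] := boolP (a == b).
  by exists [::]; constructor.
have ex_m : exists m, (f a == f m) && (a <= m < b) by exists a; rewrite eqxx /=; lia.
have bnd i : (f a == f i) && (a <= i < b) -> i <= b by lia.
case: (ex_maxnP ex_m bnd) => m /andP[/eqP fam /andP[am mb]] mmax.
have [||||ss Hss] := Hb a m; [lia|lia|by []| |].
  by apply: crossing_free_sub nc; lia.
have bmk : b - m.+1 < k by lia.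
have [|||ts Hts] := (IH _ bmk).1 m.+1 b; [lia|by []| |].
  by apply: crossing_free_sub nc; lia.
exists (PNode ss :: ts); apply: (wmatch_cons Hss) => // u v /andP[au um] /andP[mv vb] fuv.
(* A block with labels on both sides of [m] either crosses the block of [a] and [m] or is that
   block, against the maximality of [m]. *)
suff fau : f a = f v by have := mmax v; rewrite fau eqxx; lia.
rewrite -fuv; have [/eqP -> //|ua] := boolP (u == a).
have [/eqP -> //|uNm] := boolP (u == m).
by apply: (nc a u m v) => //; lia.
Qed.

Lemma wmatch_exists a b : a <= b -> crossing_free f a b -> exists ts, wmatch f a ts b.
Proof. by move=> ab; apply: (crossing_free_match (b - a)).1. Qed.

End MatchingTheory.

(** * Forests as codes of partitions: invariance, uniqueness and existence *)

Section MatchingPairs.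
Local Open Scope nat_scope.

(** Only the equivalence relation induced by the labels matters; integer labels can thus be
    exchanged for blocks. *)
Lemma match_congr (T T' : eqType) (f : nat -> T) (g : nat -> T') :
  (forall a ts b, wmatch f a ts b ->
     (forall u v, a <= u < b -> a <= v < b -> f u = f v <-> g u = g v) ->
     wmatch g a ts b) /\
  (forall x ss m, bmatch f x ss m ->
     (forall u v, x <= u <= m -> x <= v <= m -> f u = f v <-> g u = g v) ->
     bmatch g x ss m).
Proof.
apply: match_ind => /= [a|a m b ss ts Hb IHb Hw IHw sep fg|m|x y m ts ss Hw IHw fxy Hb IHb sep fg];
  try by constructor.
- have am := bmatch_le Hb; have mb := wmatch_le Hw.
  apply: (@wmatch_cons _ _ a m).
  + by apply: IHb => u v *; apply: fg; lia.
  + by apply: IHw => u v *; apply: fg; lia.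
  + by move=> u v Hu Hv /(fg u v) guv; apply: (sep u v Hu Hv); apply: guv; lia.
- have ym := bmatch_le Hb; have xy := wmatch_le Hw.
  apply: (@bmatch_cons _ _ x y).
  + by apply: IHw => u v *; apply: fg; lia.
  + by apply/fg => //; lia.
  + by apply: IHb => u v *; apply: fg; lia.
  + by move=> u v Hu Hv /(fg u v) guv; apply: (sep u v Hu Hv); apply: guv; lia.
Qed.

(* A forest determines both the length of the interval that it describes and
   the partition of this interval. *)
Lemma match_determined (T T' : eqType) (f : nat -> T) (g : nat -> T') :
  (forall a ts b, wmatch f a ts b -> forall b', wmatch g a ts b' ->
     b = b' /\
     forall u v, a <= u < b -> a <= v < b -> f u = f v <-> g u = g v) /\
  (forall x ss m, bmatch f x ss m -> forall m', bmatch g x ss m' ->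
     m = m' /\
     forall u v, x <= u <= m -> x <= v <= m -> f u = f v <-> g u = g v).
Proof.
apply: match_ind.
- by move=> a b' H; inversion H; subst; split=> // u v; lia.
- move=> a m b ss ts _ IHb _ IHw sepf b' H.
  have [m' [/IHb[<- eb] /IHw[<- ew] sepg]] := wmatch_consE H.
  split=> // u v Hu Hv.
  have [um|mu] := leqP u m; have [vm|mv] := leqP v m.
  + by apply: eb; lia.
  + by split=> E; [case: (sepf u v)|case: (sepg u v)] => //; lia.
  + by split=> E; [case: (sepf v u)|case: (sepg v u)] => //; lia.
  + by apply: ew; lia.
- move=> m m' H; inversion H; subst; split=> // u v Hu Hv.
  by have -> : u = v by lia.
- move=> x y m ts ss Hw IHw fxy Hb IHb sepf m' H.
  have [y' [/IHw[<- ew] gxy /IHb[<- eb] sepg]] := bmatch_consE H.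
  have xy := wmatch_le Hw; have ym := bmatch_le Hb.
  split=> // u v Hu Hv.
  have main u' v' : x <= u' <= m -> x <= v' <= m -> u' <= v' -> f u' = f v' <-> g u' = g v'.
    move=> {}Hu {}Hv uv.
    have [/eqP ux|uNx] := boolP (u' == x).
      have [/eqP vx|vNx] := boolP (v' == x); first by rewrite ux vx.
      rewrite ux fxy gxy.
      have [vy|yv] := ltnP v' y; last by apply: eb; lia.
      by split=> E; [case: (sepf v' y)|case: (sepg v' y)] => //; lia.
    have [uy|yu] := ltnP u' y; last by apply: eb; lia.
    have [vy|yv] := ltnP v' y; first by apply: ew; lia.
    by split=> E; [case: (sepf u' v')|case: (sepg u' v')] => //; lia.
  have [uv|/ltnW vu] := leqP u v; first exact: main.
  by split=> /esym ?; apply/esym/main.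
Qed.

(** Labels are kept inside the interval that they label, so that gluing adjacent labellings merges
    no blocks; the block of a black vertex is labelled by its last element [m]. *)
Lemma match_realizable (ts : seq ptree) :
  (forall a, exists b (f : nat -> nat),
     wmatch f a ts b /\ forall u, a <= u < b -> a <= f u < b) /\
  (forall x, exists m (f : nat -> nat),
     [/\ bmatch f x ts m, f m = m & forall u, x <= u <= m -> x <= f u <= m]).
Proof.
elim/forest_ind: ts => [|ss ts [ssw ssb] [tsw tsb]].
  split=> a.
    by exists a, id; split=> //; constructor.
  by exists a, id; split=> //; constructor.
split=> a.
- have [m [f [Hf fm Rf]]] := ssb a.
  have [b [g [Hg Rg]]] := tsw m.+1.
  have am := bmatch_le Hf; have mb := wmatch_le Hg.
  exists b, (fun u => if u <= m then f u else g u); split; last first.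
    move=> u Hu; case: (leqP u m) => um; first by have := Rf u ltac:(lia); lia.
    by have := Rg u ltac:(lia); lia.
  apply: (@wmatch_cons _ _ a m).
  + apply: (match_congr _ _).2 Hf _ => u v /andP[_ um] /andP[_ vm].
    by rewrite um vm.
  + apply: (match_congr _ _).1 Hg _ => u v Hu Hv.
    by rewrite !ifF //; lia.
  + move=> u v /andP[au um] /andP[mv vb]; rewrite um leqNgt mv /=.
    by have := Rf u ltac:(lia); have := Rg v ltac:(lia); lia.
- have [y [f [Hf Rf]]] := ssw a.+1.
  have [m [g [Hg gm Rg]]] := tsb y.
  have ay := wmatch_le Hf; have ym := bmatch_le Hg.
  (* The new element [a] joins the block of [y], which [g] labels by [m]. *)
  exists m, (fun u => if u == a then m else if u < y then f u else g u).
  have gy : g y = m by rewrite (bmatch_eq Hg).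
  split.
  + apply: (@bmatch_cons _ _ a y).
    * apply: (match_congr _ _).1 Hf _ => u v Hu Hv.
      by rewrite !(ifF _ _ (_ : (_ == a) = false)) ?ifT //; lia.
    * by rewrite eqxx ltnn gy; case: eqP.
    * apply: (match_congr _ _).2 Hg _ => u v Hu Hv.
      by rewrite !(ifF _ _ (_ : (_ == a) = false)) ?ifF //; lia.
    * move=> u v Hu Hv.
      rewrite !(ifF _ _ (_ : (_ == a) = false)); try lia.
      rewrite ifT ?ifF; try lia.
      by have := Rf u ltac:(lia); have := Rg v ltac:(lia); lia.
  + by rewrite !ifF //; lia.
  + move=> u Hu; case: eqP => [|/eqP] ua; first by lia.
    case: (ltnP u y) => uy; first by have := Rf u ltac:(lia); lia.
    by have := Rg u ltac:(lia); lia.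
Qed.

End MatchingPairs.

(** * The tree of a labelling *)

Lemma big_vertices (S : Type) (idx : S) (op : Monoid.law idx)
    (F : nat -> nat -> S) (ts : seq ptree) :
  \big[op/idx]_(u <- vertices (PNode ts)) F (size u) (nb_children (PNode ts) u) =
  op (F 0%N (size ts))
     (\big[op/idx]_(t <- ts) \big[op/idx]_(u <- vertices t)
        F (size u).+1 (nb_children t u)).
Proof.
rewrite /= big_cons; congr (op _ _).
set forest := (X in bigop _ (X 0%N ts) _).
(* The local [forest] numbers the trees from the count of those already passed, while [nb_children]
   looks a child up in the whole list; hence the prefix [pre]. *)
suff gen pre l :
  \big[op/idx]_(u <- forest (size pre) l) F (size u) (nb_children (PNode (pre ++ l)) u) =
  \big[op/idx]_(t <- l) \big[op/idx]_(u <- vertices t) F (size u).+1 (nb_children t u).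
  exact: (gen [::] ts).
elim: l pre => [|t l IHl] pre; first by rewrite !big_nil.
rewrite /= big_cat big_map big_cons; congr (op _ _).
  by apply: eq_bigr => u _ /=; rewrite nth_cat ltnn subnn.
by rewrite -cat_rcons -(IHl (rcons pre t)) size_rcons.
Qed.

Definition forest_size (ts : seq ptree) : nat := \sum_(t <- ts) size (vertices t).

Lemma size_vertices ts : size (vertices (PNode ts)) = (forest_size ts).+1.
Proof.
rewrite -sum1_size (big_vertices _ (fun _ _ => 1%N)) /= add1n; congr _.+1.
by apply: eq_bigr => t _; rewrite sum1_size.
Qed.

Section Intervals.
Local Open Scope nat_scope.
Variables (T : eqType) (f : nat -> T) (n : nat).

(** Each label carries one edge, and each vertex hangs from one edge. In the black case [m] is left
    out, as its edge leads up to the parent. *)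
Lemma match_size :
  (forall a ts b, wmatch f a ts b -> forest_size ts = b - a) /\
  (forall x ss m, bmatch f x ss m -> forest_size ss = m - x).
Proof.
rewrite /forest_size; apply: match_ind => [a|a m b ss ts Hb IHb Hw IHw _|m|x y m ts ss Hw IHw _ Hb IHb _].
- by rewrite big_nil subnn.
- rewrite big_cons size_vertices /forest_size IHb IHw.
  by have := bmatch_le Hb; have := wmatch_le Hw; lia.
- by rewrite big_nil subnn.
- rewrite big_cons size_vertices /forest_size IHb IHw.
  by have := bmatch_le Hb; have := wmatch_le Hw; lia.
Qed.

(* Only the block of [m] may leave the interval from [x] to [m]. *)
Definition closed_upto_last (x m : nat) : Prop :=
  forall u v, x <= u <= m -> v < n -> f u = f v -> x <= v <= m \/ f u = f m.

Lemma closed_in_split a m b : a <= m -> m < b -> b <= n ->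
  (forall u v, a <= u <= m -> m < v < b -> f u <> f v) ->
  closed_in f n a b -> closed_in f n a m.+1 /\ closed_in f n m.+1 b.
Proof.
move=> am mb bn sep cl.
have key u v : u < n -> v < n -> f u = f v -> a <= u < m.+1 -> a <= v < m.+1.
  move=> un vn fuv Hu; have := cl u v un vn fuv.
  have [vm|mv] := leqP v m; first by lia.
  move=> E; have [] := sep u v _ _ fuv; lia.
have {}key u v : u < n -> v < n -> f u = f v -> (a <= u < m.+1) = (a <= v < m.+1).
  by move=> un vn fuv; apply/idP/idP; apply: key.
split=> // u v un vn fuv; have := key u v un vn fuv; have := cl u v un vn fuv; lia.
Qed.

Lemma closed_in_upto_last x m : closed_in f n x m.+1 -> m < n -> closed_upto_last x m.
Proof. by move=> cl mn u v Hu vn fuv; left; have := cl u v _ vn fuv; lia. Qed.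

Lemma closed_upto_last_split x y m : x < y -> y <= m -> m < n ->
  f x = f m -> f y = f m ->
  (forall u v, x < u < y -> y <= v <= m -> f u <> f v) ->
  closed_upto_last x m -> closed_in f n x.+1 y /\ closed_upto_last y m.
Proof.
move=> xy ym mn fxm fym sep cl.
have fum u : x < u < y -> f u <> f m by move=> Hu; apply: sep => //; lia.
have key u v : u < n -> v < n -> f u = f v -> x < u < y -> x < v < y.
  move=> un vn fuv Hu; have Hu' : x <= u <= m by lia.
  case: (cl u v Hu' vn fuv) => [Hv|E]; last by case: (fum u Hu).
  have vx : v != x by apply/eqP => vx; apply: (fum u) => //; rewrite fuv vx.
  by have [vy|yv] := ltnP v y; [lia|case: (sep u v) => //; lia].
split=> [u v un vn fuv|u v Hu vn fuv]; first by apply/idP/idP; apply: key.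
have Hu' : x <= u <= m by lia.
case: (cl u v Hu' vn fuv) => [Hv|]; last by right.
have [yv|vy] := leqP y v; first by left; lia.
have [/eqP vx|vx] := boolP (v == x); first by right; rewrite fuv vx.
by case: (sep v u) => //; lia.
Qed.

(* The arc [p] comes just before the label [p] (counted from 0); two arcs bound
   the same white face when no block has labels on both sides. *)
Definition same_face (p q : nat) : bool := `[< closed_in f n (minn p q) (maxn p q) >].

Definition share (black : bool) (i j : nat) : bool :=
  if black then f i == f j else same_face i.+1 j.+1.

(** Combinatorial copy of [dual_subtree] on labels counted from 0: the edge [i] meets its white face
    at the arc [i.+1], and the two ranges list the labels cyclically after [i]. *)
Fixpoint label_subtree (h : nat) (black : bool) (i : nat) : ptree :=
  if h is h'.+1 then
    PNode [seq label_subtree h' (~~ black) j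
             | j <- iota i.+1 (n - i.+1) ++ iota 0 i & share black i j]
  else PNode [::].

Lemma filter_iota0 (p : pred nat) i k :
  (forall j, i <= j < i + k -> ~~ p j) -> [seq j <- iota i k | p j] = [::].
Proof.
move=> H; apply/eqP; rewrite -[_ == _]negbK -has_filter; apply/hasPn => j.
by rewrite mem_iota => /H.
Qed.

Lemma iota_split i j k : i <= j -> j <= k -> iota i (k - i) = iota i (j - i) ++ iota j (k - j).
Proof. by move=> ij jk; rewrite -{2}(subnKC ij) -iotaD; congr iota; lia. Qed.

(** A black vertex is entered through the largest label [m] of its block, a white one through the
    label [x] just before its gap, so the cyclic order reads the interval from its left end;
    closedness discards the labels outside. The arc [p] is a fixed arc of the white face, and the
    number of vertices bounds the height. *)
Lemma label_subtree_match :
  (forall a ts b, wmatch f a ts b -> forall p h, p <= a -> b <= n ->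
     closed_in f n p a -> closed_in f n a b -> forest_size ts <= h ->
     [seq label_subtree h true j | j <- iota a (b - a) & same_face p j.+1] = ts) /\
  (forall x ss m, bmatch f x ss m -> forall h, m < n ->
     closed_upto_last x m -> forest_size ss <= h ->
     [seq label_subtree h false j | j <- iota x (m - x) & f m == f j] = ss).
Proof.
rewrite /forest_size; apply: match_ind => [a|a m b ss ts Hb IHb Hw IHw sep|m|x y m ts ss Hw IHw fxy Hb IHb sep].
- by move=> p h _ _ _ _ _; rewrite subnn.
- move=> p h pa bn clp cl; rewrite big_cons size_vertices /forest_size => sh.
  have am := bmatch_le Hb; have mb := wmatch_le Hw.
  have [cl1 cl2] := closed_in_split am mb bn sep cl.
  have clpm : closed_in f n p m.+1.
    by move=> u v un vn fuv; have := clp u v un vn fuv; have := cl1 u v un vn fuv; lia.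
  rewrite (@iota_split a m b) ?(ltnW mb) // -[b - m](subnSK mb) /=.
  (* In the interval of the first block only [m] leads to this face: any earlier arc leaves [a] and
     [m] on different sides. *)
  rewrite filter_cat map_cat filter_iota0 /=; last first.
    move=> j Hj; apply/asboolPn => H; have := H a m.
    by rewrite (bmatch_eq Hb) => /(_ ltac:(lia) ltac:(lia) erefl); lia.
  have -> : same_face p m.+1.
    by apply/asboolP; rewrite (minn_idPl _) ?(maxn_idPr _) //; lia.
  rewrite /=; congr (_ :: _); last by apply: IHw => //; lia.
  case: h sh => [|h] sh /=; first by lia.
  congr PNode; rewrite filter_cat map_cat filter_iota0 /=; last first.
    move=> j Hj; apply/eqP => fmj; have := cl1 m j ltac:(lia) ltac:(lia) fmj; lia.
  have := @iota_split 0 a m (leq0n a) am; rewrite !subn0 => ->; rewrite filter_cat map_cat filter_iota0 /=; last first.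
    move=> j Hj; apply/eqP => fmj; have := cl1 m j ltac:(lia) ltac:(lia) fmj; lia.
  by apply: IHb; [lia|exact: closed_in_upto_last cl1 ltac:(lia)|lia].
- by move=> h _ _ _; rewrite subnn.
- move=> h mn cl; rewrite big_cons size_vertices /forest_size => sh.
  have xy := wmatch_le Hw; have ym := bmatch_le Hb; have fym := bmatch_eq Hb.
  have fxm : f x = f m by rewrite fxy.
  have [cl1 cl2] := closed_upto_last_split xy ym mn fxm fym sep cl.
  rewrite (@iota_split x y m) ?(ltnW xy) // -[y - x](subnSK xy) /= fxm eqxx /=.
  rewrite filter_cat map_cat filter_iota0 /=; last first.
    move=> j Hj; apply/eqP => fmj; apply: (sep j m); [lia|lia|by rewrite fmj].
  congr (_ :: _); last by apply: IHb => //; lia.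
  case: h sh => [|h] sh /=; first by lia.
  congr PNode.
  have Nsame j : j < n -> ~~ (x <= j < y) -> ~~ same_face x.+1 j.+1.
    move=> jn Hj; apply/asboolPn => H; have := H x y.
    by rewrite fxy => /(_ ltac:(lia) ltac:(lia) erefl); lia.
  rewrite (@iota_split x.+1 y n) //; last by lia.
  rewrite -catA filter_cat map_cat [in X in _ ++ X]filter_cat.
  rewrite ![seq.filter _ (iota y _)]filter_iota0 ?[seq.filter _ (iota 0 _)]filter_iota0 /= ?cats0;
    try by move=> j Hj; apply: Nsame; lia.
  apply: IHw; try lia; last by [].
  by move=> u v _ _ _; lia.
Qed.

Lemma label_tree_match ts : wmatch f 0 ts n ->
  PNode [seq label_subtree n true j | j <- iota 0 n & same_face n j.+1] = PNode ts.
Proof.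
move=> Hw; congr PNode.
have := label_subtree_match.1 _ _ _ Hw 0 n; rewrite subn0 => <- //.
(* The root is given by the arc [n], the induction starts at the arc 0: these agree because an
   interval is a union of blocks exactly when its complement is. *)
- congr map; apply: eq_in_filter => j; rewrite mem_iota => Hj.
  by apply/asboolP/asboolP => H u v un vn fuv; have := H u v un vn fuv; lia.
- by move=> u v un vn _; lia.
- by rewrite (match_size.1 _ _ _ Hw) subn0.
Qed.

End Intervals.

(** * Product weights of trees and of blocks *)

Section Weights.
Variables (R : comNzRingType) (T : eqType) (f : nat -> T) (n : nat).

Definition tree_prod (g : bool -> nat -> R) (black : bool) (t : ptree) : R :=
  \prod_(u <- vertices t) g (black (+) odd (size u)) (nb_children t u).

Lemma tree_prodE g black ts : tree_prod g black (PNode ts) =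
  g black (size ts) * \prod_(t <- ts) tree_prod g (~~ black) t.
Proof.
rewrite /tree_prod (big_vertices _ (fun k => g (black (+) odd k))) addbF.
by congr (_ * _); apply: eq_bigr => t _; apply: eq_bigr => u _; rewrite /= addNb -addbN.
Qed.

(** A block is represented by its largest label, the one at which [wmatch_cons] attaches its black
    vertex. *)
Definition block_max (k : nat) : bool :=
  all (fun v => f v != f k) (iota k.+1 (n - k.+1)).

Definition block_size (k : nat) : nat := count (fun v => f k == f v) (iota 0 n).

Lemma block_maxP k : reflect (forall v, (k < v < n)%N -> f v <> f k) (block_max k).
Proof.
apply: (iffP allP) => H v => [Hv|].
  by apply/eqP/H; rewrite mem_iota; lia.
by rewrite mem_iota => Hv; apply/eqP/H; lia.
Qed.

(** Each label contributes one factor [d]: the largest label of a block pays for one child of the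
    white parent, any other label for the extra unit in the exponent of the white vertex below it.
    Thus [d ^+ size ts] is the weight of the white parent without its own extra unit. *)
Lemma match_weight (d : R) (w : nat -> R) :
  let g := fun black k => if black then w k.+1 else d ^+ k.+1 in
  (forall a ts b, wmatch f a ts b -> (b <= n)%N -> closed_in f n a b ->
     d ^+ size ts * \prod_(t <- ts) tree_prod g true t =
     d ^+ (b - a) * \prod_(a <= k < b | block_max k) w (block_size k)) /\
  (forall x ss m, bmatch f x ss m -> (m < n)%N -> closed_upto_last f n x m ->
     count (fun v => f m == f v) (iota x (m - x)) = size ss /\
     \prod_(t <- ss) tree_prod g false t =
     d ^+ (m - x) * \prod_(x <= k < m | block_max k) w (block_size k)).
Proof.
move=> g; apply: match_ind => [a|a m b ss ts Hb IHb Hw IHw sep|m|x y m ts ss Hw IHw fxy Hb IHb sep].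
- by move=> _ _; rewrite subnn big_geq // big_nil !expr0.
- move=> bn cl; have am := bmatch_le Hb; have mb := wmatch_le Hw.
  have [cl1 cl2] := closed_in_split am mb bn sep cl.
  have mn : (m < n)%N by lia.
  have [cnt prd] := IHb mn (closed_in_upto_last cl1 mn).
  have mmax : block_max m.
    by apply/block_maxP => v Hv fvm; have := cl1 v m ltac:(lia) mn fvm; lia.
  (* One label for each white child, and [m] itself; closedness excludes any other. *)
  have szm : block_size m = (size ss).+1.
    rewrite -cnt /block_size; have := @iota_split 0 a n (leq0n a) ltac:(lia).
    rewrite !subn0 (@iota_split a m n) //; last lia.
    rewrite -[(n - m)%N](subnSK mn) /= => ->; rewrite !count_cat /= eqxx.
    have out i j : (forall v, (i <= v < i + j)%N -> (v < n)%N && ~~ (a <= v <= m)%N) ->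
        count (fun v => f m == f v) (iota i j) = 0%N.
      move=> H; apply/eqP; rewrite -[_ == _]negbK -lt0n -has_count; apply/hasPn => v.
      rewrite mem_iota => /H Hv; apply/eqP => fmv.
      by have := cl1 m v mn ltac:(lia) fmv; lia.
    by rewrite (out 0%N a) ?(out m.+1) ?addn0 ?add0n ?addn1 ?addnS //; lia.
  rewrite big_cons /= exprS tree_prodE /= prd.
  rewrite (@big_cat_nat _ _ _ m.+1 a b) //=; last by lia.
  rewrite [X in _ = _ * (X * _)]big_mkcond big_nat_recr //= -big_mkcond mmax szm.
  rewrite -(mulrA d) (mulrCA (d ^+ size ts)) IHw //.
  have -> : (b - a = (m - a).+1 + (b - m.+1))%N by lia.
  by rewrite exprD exprS; ring.
- by move=> _ _; rewrite subnn big_geq // big_nil mulr1.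
- move=> mn cl; have xy := wmatch_le Hw; have ym := bmatch_le Hb.
  have fym := bmatch_eq Hb; have fxm : f x = f m by rewrite fxy.
  have [cl1 cl2] := closed_upto_last_split xy ym mn fxm fym sep cl.
  have [cnt prd] := IHb mn cl2.
  have xNmax : ~~ block_max x by apply/block_maxP => H; apply: (H y) => //; lia.
  split.
    rewrite (@iota_split x y m) ?(ltnW xy) // -[(y - x)%N](subnSK xy) /= fxm eqxx /=.
    rewrite count_cat cnt; suff -> : count (fun v => f m == f v) (iota x.+1 (y - x.+1)) = 0%N by [].
    apply/eqP; rewrite -[_ == _]negbK -lt0n -has_count; apply/hasPn => v.
    by rewrite mem_iota => Hv; apply/eqP => fmv; apply: (sep v m) => //; lia.
  rewrite big_cons tree_prodE /= prd exprS -(mulrA d) IHw //; last by lia.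
  rewrite (@big_cat_nat _ _ _ y x m) ?(ltnW xy) //= (@big_ltn_cond _ _ _ x y) // (negbTE xNmax).
  have -> : (m - x = 1 + (y - x.+1) + (m - y))%N by lia.
  by rewrite !exprD; ring.
Qed.

Lemma tree_prod_match (d : R) (w : nat -> R) ts : wmatch f 0 ts n ->
  tree_prod (fun black k => if black then w k.+1 else d ^+ k.+1) false (PNode ts) =
  d ^+ n.+1 * \prod_(0 <= k < n | block_max k) w (block_size k).
Proof.
move=> Hw; rewrite tree_prodE /= !exprS -mulrA ((match_weight d w).1 _ _ _ Hw) //.
  by rewrite subn0 mulrA.
by move=> u v un vn _; lia.
Qed.

End Weights.

(** * Polygons inscribed in the circle *)

Section Geometry.
Variable R : realType.

(* Twice the signed area of the triangle [a], [b], [x], positive when the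
   vertices are in clockwise order. *)
Definition orient (a b x : plane R) : R :=
  (b.2 - a.2) * (x.1 - a.1) - (b.1 - a.1) * (x.2 - a.2).

Lemma orient_rot a b x : orient b x a = orient a b x.
Proof. by rewrite /orient; ring. Qed.

Lemma orient_swap a b x : orient a x b = - orient a b x.
Proof. by rewrite /orient; ring. Qed.

(** Sum-to-product formulas turn the coordinate differences into half-angles; the sine of [X - B]
    then arises by expanding that of [(X + A) - (B + A)]. *)
Lemma orient_circle (n : nat) (a b x : R) :
  orient (circle_pt n a) (circle_pt n b) (circle_pt n x) =
  4 * sin (pi * (b - a) / n%:R) * sin (pi * (x - b) / n%:R) * sin (pi * (x - a) / n%:R).
Proof.
have cosBB (u v : R) : cos (2 * u) - cos (2 * v) = - 2 * sin (u + v) * sin (u - v).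
  have -> : 2 * u = (u + v) + (u - v) by ring.
  have -> : 2 * v = (u + v) - (u - v) by ring.
  by move: (u + v) (u - v) => s d; rewrite cosD cosB; ring.
have sinBB (u v : R) : sin (2 * u) - sin (2 * v) = 2 * cos (u + v) * sin (u - v).
  have -> : 2 * u = (u + v) + (u - v) by ring.
  have -> : 2 * v = (u + v) - (u - v) by ring.
  by move: (u + v) (u - v) => s d; rewrite sinD sinB; ring.
rewrite /orient /circle_pt /= -!mulrA !opprK ![- sin _ + _]addrC !sinBB !cosBB.
set A := pi * (a / _); set B := pi * (b / _); set X := pi * (x / _).
have -> : pi * ((b - a) / n%:R) = B - A by rewrite /A /B; ring.
have -> : pi * ((x - b) / n%:R) = X - B by rewrite /X /B; ring.
have -> : pi * ((x - a) / n%:R) = X - A by rewrite /X /A; ring.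
have -> : X - B = (X + A) - (B + A) by ring.
have -> : A - B = - (B - A) by ring.
have -> : A - X = - (X - A) by ring.
by rewrite [sin (_ - (B + A))]sinB !sinN [A + B]addrC [A + X]addrC; ring.
Qed.

(** Within less than one turn the three half-arcs lie strictly between 0 and [pi]. Other cyclic
    orders are reduced to this one by [orient_rot] and [orient_swap]. *)
Lemma orient_circle_gt0 (n : nat) (a b x : R) : a < b -> b < x -> x - a < n%:R ->
  0 < orient (circle_pt n a) (circle_pt n b) (circle_pt n x).
Proof.
move=> ab bx xan; rewrite orient_circle.
have n0 : (0 : R) < n%:R by lra.
have sin0 (t : R) : 0 < t -> t < n%:R -> 0 < sin (pi * t / n%:R).
  move=> t0 tn; apply: sin_gt0_pi.
  rewrite divr_gt0 ?mulr_gt0 ?pi_gt0 //=.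
  by rewrite ltr_pdivrMr // ltr_pM2l ?pi_gt0.
by rewrite !mulr_gt0 ?sin0 //; lra.
Qed.

Lemma circle_pt_norm (n : nat) (x : R) :
  (circle_pt n x).1 ^+ 2 + (circle_pt n x).2 ^+ 2 = 1.
Proof. by rewrite /circle_pt /= sqrrN cos2Dsin2. Qed.

Lemma orient_hull (n : nat) (B : {set 'I_n}) (a b x : plane R) : hull R B x ->
  exists2 k : 'I_n -> R, (forall i, i \in B -> 0 <= k i) /\ \sum_(i in B) k i = 1 &
    orient a b x = \sum_(i in B) k i * orient a b (vertex R i).
Proof.
case=> k [k0 k1 ->]; exists k => //.
have E1 : (\sum_(i in B) k i *: vertex R i).1 = \sum_(i in B) k i * (vertex R i).1.
  by rewrite (big_morph (fun z : plane R => z.1) (id1 := 0) (op1 := +%R)).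
have E2 : (\sum_(i in B) k i *: vertex R i).2 = \sum_(i in B) k i * (vertex R i).2.
  by rewrite (big_morph (fun z : plane R => z.2) (id1 := 0) (op1 := +%R)).
have shift (c : R) (z : 'I_n -> R) :
    \sum_(i in B) k i * z i - c = \sum_(i in B) k i * (z i - c).
  by rewrite -{1}[c]mul1r -k1 mulr_suml -sumrB; apply: eq_bigr => i _; ring.
by rewrite /orient E1 E2 !shift !mulr_sumr -sumrB; apply: eq_bigr => i _; ring.
Qed.

(** The inequality stays strict because the weights add up to 1 and so cannot all vanish. *)
Lemma orient_hull_gt0 (n : nat) (B : {set 'I_n}) (a b x : plane R) : hull R B x ->
  (forall i, i \in B -> 0 < orient a b (vertex R i)) -> 0 < orient a b x.
Proof.
move=> /(orient_hull a b)[k [k0 k1] ->] pos.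
have kp0 i : i \in B -> 0 <= k i * orient a b (vertex R i).
  by move=> iB; rewrite mulr_ge0 ?k0 // ltW ?pos.
rewrite lt0r sumr_ge0 // andbT; apply/eqP => /psumr_eq0P E.
have : \sum_(i in B) k i = 0.
  apply: big1 => i iB; apply/eqP; have /eqP := E kp0 i iB.
  by rewrite mulf_eq0 => /orP[//|]; rewrite gt_eqF ?pos.
by rewrite k1 => /eqP; rewrite oner_eq0.
Qed.

Lemma orient_hull_lt0 (n : nat) (B : {set 'I_n}) (a b x : plane R) : hull R B x ->
  (forall i, i \in B -> orient a b (vertex R i) < 0) -> orient a b x < 0.
Proof.
move=> xB neg; rewrite -oppr_gt0.
have oC y : - orient a b y = orient b a y by rewrite /orient; ring.
by rewrite oC; apply: orient_hull_gt0 xB _ => i iB; rewrite -oC oppr_gt0 neg.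
Qed.

Lemma hull_segment (n : nat) (B : {set 'I_n}) (u v : 'I_n) (t : R) :
  u \in B -> v \in B -> u != v -> 0 <= t -> t <= 1 ->
  hull R B ((1 - t) *: vertex R u + t *: vertex R v).
Proof.
move=> uB vB uv t0 t1.
exists (fun i => if i == u then 1 - t else if i == v then t else 0); split.
- by move=> i _; case: ifP => _; [lra|case: ifP].
- rewrite (bigD1 u) //= (bigD1 v) /= ?vB 1?eq_sym //= eqxx eq_sym (negbTE uv) eqxx.
  rewrite big1 ?addr0 ?subrK // => i /andP[/andP[_ /negbTE ->] /negbTE ->] //.
- rewrite (bigD1 u) //= (bigD1 v) /= ?vB 1?eq_sym //= eqxx eq_sym (negbTE uv) eqxx.
  by rewrite big1 ?addr0 // => i /andP[/andP[_ /negbTE ->] /negbTE ->]; rewrite scale0r.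
Qed.

Definition arc_pt (n l : nat) : plane R := circle_pt n (l%:R + 2^-1).

(** The vertex of [u] sits at position [u + 1] and the midpoints at [p + 1/2] and [q + 1/2], hence
    the large inequality on the left and the strict one on the right. *)
Lemma orient_arcs (n p q : nat) (u : 'I_n) : (0 < p)%N -> (p < q)%N -> (q <= n)%N ->
  if (p <= u < q)%N then orient (arc_pt n p) (arc_pt n q) (vertex R u) < 0
  else 0 < orient (arc_pt n p) (arc_pt n q) (vertex R u).
Proof.
move=> p0 pq qn; rewrite /arc_pt /vertex.
have un := ltn_ord u.
have p0' : (1 : R) <= p%:R by rewrite (ler_nat _ 1).
have pq' : (p%:R : R) + 1 <= q%:R by rewrite natr1 ler_nat.
have qn' : (q%:R : R) <= n%:R by rewrite ler_nat.
have un' : (u.+1%:R : R) <= n%:R by rewrite ler_nat.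
have u0' : (1 : R) <= u.+1%:R by rewrite (ler_nat _ 1).
case: ifPn => [/andP[pu uq]|].
  have pu' : (p%:R : R) + 1 <= u.+1%:R by rewrite natr1 ler_nat.
  have uq' : (u.+1%:R : R) <= q%:R by rewrite ler_nat.
  by rewrite -oppr_gt0 -orient_swap; apply: orient_circle_gt0; lra.
rewrite negb_and -!ltnNge => /orP[up|qu].
  have up' : (u.+1%:R : R) <= p%:R by rewrite ler_nat.
  by rewrite orient_rot; apply: orient_circle_gt0; lra.
have qu' : (q%:R : R) + 1 <= u.+1%:R by rewrite natr1 ler_nat.
by apply: orient_circle_gt0; lra.
Qed.

Lemma orient_vertices (n p : nat) (u v : 'I_n) : (0 < p)%N -> (p <= n)%N -> (u < v)%N ->
  if (u < p <= v)%N then orient (vertex R u) (vertex R v) (arc_pt n p) < 0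
  else 0 < orient (vertex R u) (vertex R v) (arc_pt n p).
Proof.
move=> p0 pn uv; have := ltn_ord v; rewrite /arc_pt /vertex => vn.
have p0' : (1 : R) <= p%:R by rewrite (ler_nat _ 1).
have pn' : (p%:R : R) <= n%:R by rewrite ler_nat.
have uv' : (u.+1%:R : R) + 1 <= v.+1%:R by rewrite natr1 ler_nat.
have vn' : (v.+1%:R : R) <= n%:R by rewrite ler_nat.
have u0' : (1 : R) <= u.+1%:R by rewrite (ler_nat _ 1).
case: ifPn => [/andP[up pv]|].
  have up' : (u.+1%:R : R) <= p%:R by rewrite ler_nat.
  have pv' : (p%:R : R) + 1 <= v.+1%:R by rewrite natr1 ler_nat.
  by rewrite -oppr_gt0 -orient_swap; apply: orient_circle_gt0; lra.
rewrite negb_and -!ltnNge => /orP[pu|vp].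
  have pu' : (p%:R : R) + 1 <= u.+1%:R by rewrite natr1 ler_nat.
  by rewrite orient_rot; apply: orient_circle_gt0; lra.
have vp' : (v.+1%:R : R) <= p%:R by rewrite ler_nat.
by apply: orient_circle_gt0; lra.
Qed.

(* A short chord around the midpoint of the arc cuts it off from all vertices. *)
Lemma arc_pt_not_hull (n p : nat) (B : {set 'I_n}) : (0 < p)%N -> (p <= n)%N ->
  ~ hull R B (arc_pt n p).
Proof.
move=> p0 pn.
have p0' : (1 : R) <= p%:R by rewrite (ler_nat _ 1).
have pn' : (p%:R : R) <= n%:R by rewrite ler_nat.
pose a := circle_pt n (p%:R + 4^-1 : R); pose b := circle_pt n (p%:R + 3 / 4 : R).
move=> /(@orient_hull_gt0 _ _ a b) => /(_ _) H.
have : 0 < orient a b (arc_pt n p).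
  apply: H => i _; rewrite /vertex; have := ltn_ord i => iN.
  have iN' : (i.+1%:R : R) <= n%:R by rewrite ler_nat.
  have i0' : (1 : R) <= i.+1%:R by rewrite (ler_nat _ 1).
  have [ip|pi] := ltnP i p.
    have ip' : (i.+1%:R : R) <= p%:R by rewrite ler_nat.
    by rewrite orient_rot; apply: orient_circle_gt0; lra.
  have pi' : (p%:R : R) + 1 <= i.+1%:R by rewrite natr1 ler_nat.
  by apply: orient_circle_gt0; lra.
apply/negP; rewrite -leNgt ltW // -oppr_gt0 -orient_swap.
by apply: orient_circle_gt0; lra.
Qed.

(** The parameter [t] is that of the orthogonal projection of [x] on the line. Since [a] and [b] are
    on the circle, the squared norm of [x] is [1 - t * (1 - t) * N], and the disk condition forces
    [t] between 0 and 1. *)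
Lemma orient_eq0_segment (a b x : plane R) :
  a.1 ^+ 2 + a.2 ^+ 2 = 1 -> b.1 ^+ 2 + b.2 ^+ 2 = 1 -> a <> b ->
  x.1 ^+ 2 + x.2 ^+ 2 <= 1 -> orient a b x = 0 ->
  exists2 t, 0 <= t <= 1 & x = (1 - t) *: a + t *: b.
Proof.
case: a b x => [a1 a2] [b1 b2] [x1 x2] /=; rewrite /orient /= => Na Nb ab Nx o0.
set N := (b1 - a1) ^+ 2 + (b2 - a2) ^+ 2.
have N0 : N != 0.
  rewrite paddr_eq0 ?sqr_ge0 // !sqrf_eq0 !subr_eq0; apply/negP => /andP[/eqP E1 /eqP E2].
  by apply: ab; rewrite E1 E2.
have Ngt0 : 0 < N by rewrite lt0r N0 addr_ge0 ?sqr_ge0.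
pose t := ((x1 - a1) * (b1 - a1) + (x2 - a2) * (b2 - a2)) / N.
have X1 : x1 = (1 - t) * a1 + t * b1.
  apply/eqP; rewrite -subr_eq0 -(mulIr_eq0 _ (mulIf N0)); apply/eqP.
  have tN : t * N = (x1 - a1) * (b1 - a1) + (x2 - a2) * (b2 - a2) by rewrite /t divfK.
  transitivity (x1 * N - (a1 * N + t * N * (b1 - a1))); first by ring.
  rewrite tN /N; transitivity ((b2 - a2) * ((b2 - a2) * (x1 - a1) - (b1 - a1) * (x2 - a2))); first by ring.
  by rewrite o0 mulr0.
have X2 : x2 = (1 - t) * a2 + t * b2.
  apply/eqP; rewrite -subr_eq0 -(mulIr_eq0 _ (mulIf N0)); apply/eqP.
  have tN : t * N = (x1 - a1) * (b1 - a1) + (x2 - a2) * (b2 - a2) by rewrite /t divfK.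
  transitivity (x2 * N - (a2 * N + t * N * (b2 - a2))); first by ring.
  rewrite tN /N; transitivity (- (b1 - a1) * ((b2 - a2) * (x1 - a1) - (b1 - a1) * (x2 - a2))); first by ring.
  by rewrite o0 mulr0.
exists t; last by rewrite X1 X2.
have E : x1 ^+ 2 + x2 ^+ 2 = 1 - t * (1 - t) * N.
  rewrite [in LHS]X1 [in LHS]X2 /N.
  transitivity ((1 - t) * (a1 ^+ 2 + a2 ^+ 2) + t * (b1 ^+ 2 + b2 ^+ 2) - t * (1 - t) * N).
    by rewrite /N; ring.
  by rewrite Na Nb /N; ring.
have : 0 <= t * (1 - t).
  by rewrite -(pmulr_lge0 _ Ngt0); move: Nx; rewrite E; lra.
by nra.
Qed.

End Geometry.

(** * Crossings and white faces *)

Section Faces.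
Variables (R : realType) (n : nat) (P : {set {set 'I_n}}).

(** The labelling fed to the combinatorial part; integers not below [n] get the empty set, which is
    no block of a partition. *)
Definition block_of (k : nat) : {set 'I_n} :=
  if insub k is Some i then finset.pblock P i else finset.set0.

Lemma block_of_ord (i : 'I_n) : block_of i = finset.pblock P i.
Proof. by rewrite /block_of valK. Qed.

Lemma orient_continuous (a b : plane R) : continuous (orient a b : plane R -> R).
Proof.
move=> x; rewrite /orient; apply: cvgB; apply: cvgM; try exact: cvg_cst.
  by apply: cvgB; [exact: cvg_fst|exact: cvg_cst].
by apply: cvgB; [exact: cvg_snd|exact: cvg_cst].
Qed.

Lemma segment_path_continuous (a b : plane R) :
  continuous (fun t : R => (1 - t) *: a + t *: b : plane R).
Proof.
move=> t; apply: cvgD; apply: cvgZ; try exact: cvg_cst; last exact: cvg_id.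
by apply: cvgB; [exact: cvg_cst|exact: cvg_id].
Qed.

Lemma arc_pt_white (p : nat) : (0 < p)%N -> (p <= n)%N -> white_region R P (arc_pt R n p).
Proof.
move=> p0 pn; split; first by rewrite circle_pt_norm.
by move=> B _; apply: arc_pt_not_hull.
Qed.

Lemma white_faceE (p : nat) : white_face R P p = connected_component (white_region R P) (arc_pt R n p).
Proof. by []. Qed.

(** By connectedness a change of sign gives a zero inside the component: a point of the disk on the
    line through [u] and [v], hence on their chord and in the hull of [B]. *)
Lemma same_white_face_sign (u v : 'I_n) (B : {set 'I_n}) (x y : plane R) :
  B \in P -> u \in B -> v \in B -> u != v ->
  connected_component (white_region R P) x y ->
  orient (vertex R u) (vertex R v) x < 0 ->
  0 < orient (vertex R u) (vertex R v) y -> False.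
Proof.
move=> BP uB vB uv xy xneg ypos.
have uvR : vertex R u <> vertex R v.
  by move=> E; move: xneg; rewrite E /orient !subrr !mul0r subrr ltxx.
set C := connected_component _ _ in xy.
(* The component of a point outside the region is empty, whereas this one contains [y]. *)
have Cx : C x.
  by apply: connected_component_refl; apply: contrapT => /connected_component_out E; move: xy; rewrite /C E.
have /connected_intervalP itv : connected (orient (vertex R u) (vertex R v) @` C)%classic.
  apply: connected_continuous_connected; first exact: component_connected.
  by apply: continuous_subspaceT; exact: orient_continuous.
have [z Cz z0] : (orient (vertex R u) (vertex R v) @` C)%classic 0.
  apply: (itv (orient (vertex R u) (vertex R v) x) (orient (vertex R u) (vertex R v) y)).
  - by exists x.
  - by exists y.
  - by rewrite !ltW.
have [zdisk zhull] := connected_component_sub Cz.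
have [s /andP[s0 s1] zE] := orient_eq0_segment (circle_pt_norm n u.+1%:R)
  (circle_pt_norm n v.+1%:R) uvR zdisk z0.
by apply: (zhull B BP); rewrite zE; apply: hull_segment.
Qed.

Hypothesis partP : finset.partition P [set: 'I_n]%SET.

Lemma mem_block (i : 'I_n) : i \in finset.pblock P i.
Proof. by rewrite finset.mem_pblock (finset.cover_partition partP) finset.inE. Qed.

Lemma block_mem (i : 'I_n) : finset.pblock P i \in P.
Proof. by apply: finset.pblock_mem; rewrite (finset.cover_partition partP) finset.inE. Qed.

Lemma block_of_mem (B : {set 'I_n}) (i : 'I_n) : B \in P -> i \in B -> block_of i = B.
Proof.
move=> BP iB; rewrite block_of_ord; apply: finset.def_pblock => //.
by have /and3P[] := partP.
Qed.

Lemma block_nonempty (B : {set 'I_n}) : B \in P -> exists i, i \in B.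
Proof.
move=> BP; apply/finset.set0Pn; apply: contraTneq BP => ->.
by have /and3P[] := partP.
Qed.

Lemma closed_same_face (p q : nat) : (0 < p)%N -> (p < q)%N -> (q <= n)%N ->
  closed_in block_of n p q ->
  connected_component (white_region R P) (arc_pt R n p) (arc_pt R n q).
Proof.
move=> p0 pq qn cl; set a := arc_pt R n p; set b := arc_pt R n q.
pose seg := ((fun t : R => (1 - t) *: a + t *: b : plane R) @` `[0, 1])%classic.
suff [Ca [Cb [C sub]]] : seg a /\ seg b /\ connected seg /\ (seg `<=` white_region R P)%classic.
  by apply: (connected_component_max Ca sub C).
split; first by exists 0; rewrite /= ?in_itv /= ?lexx ?ler01 // subr0 scale1r scale0r addr0.
split; first by exists 1; rewrite /= ?in_itv /= ?lexx ?ler01 // subrr scale1r scale0r add0r.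
split.
  apply: connected_continuous_connected; first exact: segment_connected.
  by apply: continuous_subspaceT; exact: segment_path_continuous.
move=> y [t Ht <-] {y seg}; move: Ht; rewrite /= in_itv /= => /andP[t0 t1]; split.
  have := circle_pt_norm n (p%:R + 2^-1 : R); have := circle_pt_norm n (q%:R + 2^-1 : R).
  rewrite -/(arc_pt R n p) -/(arc_pt R n q) -/a -/b.
  move: a b => [a1 a2] [b1 b2] /= Nb Na.
  have -> : ((1 - t) *: (a1 : R^o) + t *: (b1 : R^o)) = (1 - t) * a1 + t * b1 by [].
  have -> : ((1 - t) *: (a2 : R^o) + t *: (b2 : R^o)) = (1 - t) * a2 + t * b2 by [].
  have -> : ((1 - t) * a1 + t * b1) ^+ 2 + ((1 - t) * a2 + t * b2) ^+ 2 =
    (1 - t) * (a1 ^+ 2 + a2 ^+ 2) + t * (b1 ^+ 2 + b2 ^+ 2)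
    - t * (1 - t) * ((a1 - b1) ^+ 2 + (a2 - b2) ^+ 2) by ring.
  rewrite Na Nb !mulr1 subrK lerBlDr lerDl.
  by apply: mulr_ge0; [rewrite mulr_ge0 ?subr_ge0|rewrite addr_ge0 ?sqr_ge0].
move=> B BP xB.
(* The point is on the line through [a] and [b], while the hull of a block lies strictly on one side
   of it. *)
have o0 : orient a b ((1 - t) *: a + t *: b) = 0.
  move: a b {xB} => [a1 a2] [b1 b2]; rewrite /orient /=.
  have -> : ((1 - t) *: (a1 : R^o) + t *: (b1 : R^o)) = (1 - t) * a1 + t * b1 by [].
  have -> : ((1 - t) *: (a2 : R^o) + t *: (b2 : R^o)) = (1 - t) * a2 + t * b2 by [].
  by ring.
have [i iB] := block_nonempty BP.
have same j : j \in B -> (p <= i < q)%N = (p <= j < q)%N.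
  by move=> jB; apply: cl => //; rewrite !(@block_of_mem B).
have [Hi|Hi] := boolP (p <= i < q)%N.
  suff : orient a b ((1 - t) *: a + t *: b) < 0 by rewrite o0 ltxx.
  apply: orient_hull_lt0 xB _ => j jB; have := @orient_arcs R n p q j p0 pq qn.
  by rewrite -same // Hi.
suff : 0 < orient a b ((1 - t) *: a + t *: b) by rewrite o0 ltxx.
apply: orient_hull_gt0 xB _ => j jB; have := @orient_arcs R n p q j p0 pq qn.
by rewrite -same // (negbTE Hi).
Qed.

Lemma same_face_closed (p q : nat) : (0 < p)%N -> (p < q)%N -> (q <= n)%N ->
  connected_component (white_region R P) (arc_pt R n p) (arc_pt R n q) ->
  closed_in block_of n p q.
Proof.
move=> p0 pq qn cc.
have key u v : (u < n)%N -> (v < n)%N -> block_of u = block_of v ->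
    (p <= u < q)%N -> (p <= v < q)%N.
  move=> un vn; rewrite -[u]/(nat_of_ord (Ordinal un)) -[v]/(nat_of_ord (Ordinal vn)).
  move: (Ordinal un) (Ordinal vn) => {u v un vn} u v; rewrite !block_of_ord => Euv Hu.
  rewrite -[X in is_true X]negbK negb_and -!ltnNge; apply/negP => /orP[vp|qv].
  - have uB : u \in finset.pblock P v by rewrite -Euv mem_block.
    have vu : v != u by apply/eqP => E; move: vp Hu; rewrite E; lia.
    apply: (same_white_face_sign (block_mem v) (mem_block v) uB vu cc).
      have := @orient_vertices R n p v u p0 ltac:(lia) ltac:(lia).
      by rewrite ifT //; lia.
    have := @orient_vertices R n q v u ltac:(lia) qn ltac:(lia).
    by rewrite ifF //; lia.
  - have vB : v \in finset.pblock P u by rewrite Euv mem_block.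
    have uv : v != u by apply/eqP => E; move: qv Hu; rewrite E; lia.
    (* The chord is taken from [v] to [u], so that the negative sign falls on the arc [p]. *)
    apply: (same_white_face_sign (block_mem u) vB (mem_block u) uv cc).
      rewrite /orient.
      have := @orient_vertices R n p u v p0 ltac:(lia) ltac:(lia); rewrite ifF; last by lia.
      by rewrite /orient; lra.
    have := @orient_vertices R n q u v ltac:(lia) qn ltac:(lia); rewrite ifT; last by lia.
    by rewrite /orient; lra.
by move=> u v un vn Euv; apply/idP/idP; apply: key.
Qed.

Lemma white_face_eqP (p q : nat) : (0 < p)%N -> (p <= n)%N -> (0 < q)%N -> (q <= n)%N ->
  white_face R P p = white_face R P q <->
  closed_in block_of n (minn p q) (maxn p q).
Proof.
wlog pq : p q / (p <= q)%N.
  move=> H p0 pn q0 qn; have [pq|] := boolP (p <= q)%N; first exact: H.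
  rewrite -ltnNge => /ltnW qp.
  have [H1 H2] := H q p qp q0 qn p0 pn.
  rewrite minnC maxnC; by split=> [/esym/H1|/H2/esym].
move=> p0 pn q0 qn; rewrite (minn_idPl pq) (maxn_idPr pq).
have [/eqP <-|pNq] := boolP (p == q).
  by split=> // _ u v; lia.
have {}pq : (p < q)%N by lia.
rewrite !white_faceE; split=> [E|/closed_same_face H].
  by apply: same_face_closed => //; rewrite E; apply/connected_component_refl/arc_pt_white.
by apply: same_connected_component; apply: H.
Qed.

(* The diagonals of a convex quadrilateral [p], [q], [r], [s] meet: the four
   signed areas are the coefficients of the affine dependency of the vertices. *)
Lemma crossing_point (p q r s : plane R) :
  0 < orient q r s -> 0 < orient p r s -> 0 < orient p q s -> 0 < orient p q r ->
  exists x, (exists2 t, 0 <= t <= 1 & x = (1 - t) *: p + t *: r) /\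
            (exists2 t, 0 <= t <= 1 & x = (1 - t) *: q + t *: s).
Proof.
have frac01 (a c : R) : 0 < a -> 0 < c -> (0 <= c / (a + c) <= 1) /\ 1 - c / (a + c) = (a + c)^-1 * a.
  move=> a0 c0; have ac0 : 0 < a + c by rewrite addr_gt0.
  rewrite divr_ge0 ?(ltW c0) ?(ltW ac0) //= ler_pdivrMr // mul1r lerDr (ltW a0); split=> //.
  by field; rewrite gt_eqF.
have dep : orient q r s *: p + orient p q s *: r = orient p r s *: q + orient p q r *: s.
  suff [E1 E2] : orient q r s * p.1 + orient p q s * r.1 = orient p r s * q.1 + orient p q r * s.1 /\
                 orient q r s * p.2 + orient p q s * r.2 = orient p r s * q.2 + orient p q r * s.2.
    exact: (congr2 pair E1 E2).
  by rewrite /orient; split; ring.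
have sum_eq : orient q r s + orient p q s = orient p r s + orient p q r.
  by rewrite /orient; ring.
move: (orient q r s) (orient p r s) (orient p q s) (orient p q r) dep sum_eq => a b c d dep sum_eq.
move=> a0 b0 c0 d0; have [c01 cE] := frac01 a c a0 c0; have [d01 dE] := frac01 b d b0 d0.
(* Both sides of [dep] divided by the common value [a + c = b + d]. *)
exists ((a + c)^-1 *: (a *: p + c *: r)); split.
  by exists (c / (a + c)); rewrite // cE scalerDr !scalerA [c / _]mulrC.
by exists (d / (b + d)); rewrite // dE dep sum_eq scalerDr !scalerA [d / _]mulrC.
Qed.

(** Crossing labels of two distinct blocks are the vertices of a convex quadrilateral, whose
    diagonals meet in a point of both hulls. *)
Lemma noncrossing_crossing_free : P \in noncrossing R n -> crossing_free block_of 0 n.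
Proof.
rewrite finset.inE => /andP[_ /asboolP nc] p q r s _ pq qr rs sn.
have rn : (r < n)%N by lia.
have qn : (q < n)%N by lia.
have pn : (p < n)%N by lia.
rewrite -[p]/(nat_of_ord (Ordinal pn)) -[q]/(nat_of_ord (Ordinal qn)).
rewrite -[r]/(nat_of_ord (Ordinal rn)) -[s]/(nat_of_ord (Ordinal sn)).
have : [/\ (Ordinal pn < Ordinal qn)%N, (Ordinal qn < Ordinal rn)%N & (Ordinal rn < Ordinal sn)%N] by [].
move: (Ordinal pn) (Ordinal qn) (Ordinal rn) (Ordinal sn).
move=> {p q r s pn qn rn sn pq qr rs} p q r s [pq qr rs].
rewrite !block_of_ord => Epr Eqs; apply: contrapT => /eqP Npq.
have := nc _ _ (block_mem p) (block_mem q) Npq.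
have pos (i j k : 'I_n) : (i < j)%N -> (j < k)%N -> 0 < orient (vertex R i) (vertex R j) (vertex R k).
  move=> ij jk; have kn := ltn_ord k; apply: orient_circle_gt0; rewrite ?ltr_nat ?ltnS //.
  by rewrite -natrB ?ltr_nat ?ltnS; lia.
have [x [[t t01 xpr] [t' t'01 xqs]]] := crossing_point (pos _ _ _ qr rs)
  (pos _ _ _ (ltn_trans pq qr) rs) (pos _ _ _ pq (ltn_trans qr rs)) (pos _ _ _ pq qr).
apply/eqP/set0P; exists x; split.
  rewrite xpr; apply: hull_segment; rewrite ?mem_block ?Epr ?mem_block //; try by case/andP: t01.
  by apply/eqP => E; move: pq qr; rewrite E; lia.
rewrite xqs; apply: hull_segment; rewrite ?mem_block ?Eqs ?mem_block //; try by case/andP: t'01.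
by apply/eqP => E; move: qr rs; rewrite E; lia.
Qed.

(** Let [B] be the block with the smaller minimum. A label of [B] between the extreme labels of [C]
    would cross them together with this minimum, so a chord separates [B] from [C]. *)
Lemma crossing_free_noncrossing : crossing_free block_of 0 n -> P \in noncrossing R n.
Proof.
move=> nc; rewrite finset.inE partP /=; apply/asboolP.
have key (B C : {set 'I_n}) (b0 : 'I_n) (x : plane R) : B \in P -> C \in P -> B != C ->
    b0 \in B -> (forall c, c \in C -> b0 < c)%N -> hull R B x -> hull R C x -> False.
  move=> BP CP BC b0B b0C xB xC.
  have [c0 c0C] := block_nonempty CP.
  (* The chord cutting off the labels from [min C] to [max C] separates. *)
  case: (arg_minnP (fun i : 'I_n => nat_of_ord i) c0C) => lo loC lo_min.
  case: (arg_maxnP (fun i : 'I_n => nat_of_ord i) c0C) => hi hiC hi_max.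
  have lohi : (lo <= hi)%N by apply: lo_min.
  have b0lo := b0C _ loC; have lo0 := leq_ltn_trans (leq0n b0) b0lo; have hin := ltn_ord hi.
  have o1 : orient (arc_pt R n lo) (arc_pt R n hi.+1) x < 0.
    apply: orient_hull_lt0 xC _ => j jC.
    have := @orient_arcs R n lo hi.+1 j lo0 lohi hin.
    by rewrite ifT // lo_min // ltnS; apply: hi_max.
  have o2 : 0 < orient (arc_pt R n lo) (arc_pt R n hi.+1) x.
    apply: orient_hull_gt0 xB _ => j jB.
    have := @orient_arcs R n lo hi.+1 j lo0 lohi hin.
    rewrite ifF //; apply/negbTE/negP => /andP[loj jhi].
    apply: (elimN eqP BC); rewrite -(block_of_mem BP b0B) -(block_of_mem CP loC).
    have jNlo : j != lo.
      apply/eqP => E; apply: (elimN eqP BC).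
      by rewrite -(block_of_mem BP jB) E (block_of_mem CP loC).
    have jNhi : j != hi.
      apply/eqP => E; apply: (elimN eqP BC).
      by rewrite -(block_of_mem BP jB) E (block_of_mem CP hiC).
    have loj' : (lo < j)%N by rewrite ltn_neqAle eq_sym jNlo.
    have jhi' : (j < hi)%N by rewrite ltn_neqAle jNhi.
    apply: (nc b0 lo j hi) => //.
      by rewrite (block_of_mem BP b0B) (block_of_mem BP jB).
    by rewrite (block_of_mem CP loC) (block_of_mem CP hiC).
  by move: o1 o2; lra.
move=> B C BP CP BC; apply/eqP; rewrite -[_ == _]negbK; apply/negP => /set0P[x [xB xC]].
have [b bB] := block_nonempty BP; have [c cC] := block_nonempty CP.
case: (arg_minnP (fun i : 'I_n => nat_of_ord i) bB) => b0 b0B bmin.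
case: (arg_minnP (fun i : 'I_n => nat_of_ord i) cC) => c0 c0C cmin.
have [bc|cb|/val_inj bc] := ltngtP b0 c0.
- by apply: (key B C b0 x) => // i iC; apply: leq_trans bc (cmin i iC).
- by apply: (key C B c0 x) => //; [rewrite eq_sym|move=> i iB; apply: leq_trans cb (bmin i iB)].
- apply: (elimN eqP BC); rewrite -(block_of_mem BP b0B) bc; exact: block_of_mem.
Qed.

End Faces.

(** * The dual tree *)

Section DualTree.
Variables (R : realType) (n : nat).
Implicit Types P Q : {set {set 'I_n}}.

Lemma noncrossing_partition P :
  P \in noncrossing R n -> finset.partition P [set: 'I_n]%SET.
Proof. by rewrite finset.inE => /andP[]. Qed.

Lemma share_endE P black (i j : 'I_n) : finset.partition P [set: 'I_n]%SET ->
  share_end R P black i j = share (block_of P) n black i j.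
Proof.
move=> partP; case: black; rewrite /share_end /share; first by rewrite !block_of_ord.
by apply/asboolP/asboolP; case: (@white_face_eqP R n P partP i.+1 j.+1).
Qed.

Lemma val_clockwise_after (i : 'I_n) :
  map val (clockwise_after i) = iota i.+1 (n - i.+1) ++ iota 0 i.
Proof.
rewrite /clockwise_after -behead_map map_rot val_enum_ord /rot drop_iota take_iota.
rewrite add0n (minn_idPl (ltnW (ltn_ord i))).
by rewrite -(subnSK (ltn_ord i)).
Qed.

Lemma map_filter_val (S : Type) (s : seq 'I_n) (p : pred 'I_n) (p' : pred nat)
    (F : 'I_n -> S) (F' : nat -> S) :
  (forall i, p i = p' i) -> (forall i, F i = F' i) ->
  [seq F i | i <- s & p i] = [seq F' k | k <- map val s & p' k].
Proof.
move=> pE FE; rewrite filter_map -map_comp.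
rewrite (@eq_filter _ p (preim val p') pE); exact: eq_map.
Qed.

Lemma dual_subtreeE P h black (i : 'I_n) : finset.partition P [set: 'I_n]%SET ->
  dual_subtree R P h black i = label_subtree (block_of P) n h black i.
Proof.
move=> partP; elim: h black i => //= h IHh black i; congr PNode.
rewrite -val_clockwise_after; apply: map_filter_val => j; last exact: IHh.
exact: share_endE.
Qed.

Lemma dual_treeE P ts : finset.partition P [set: 'I_n]%SET ->
  wmatch (block_of P) 0 ts n -> dual_tree R P = PNode ts.
Proof.
move=> partP /label_tree_match <-; congr PNode.
rewrite -val_enum_ord; apply: map_filter_val => j; last exact: dual_subtreeE.
have jn := ltn_ord j; have n0 := leq_ltn_trans (leq0n j) jn.
rewrite /same_face minnC maxnC.
by apply/asboolP/asboolP; case: (@white_face_eqP R n P partP j.+1 n).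
Qed.

Lemma noncrossing_match P : P \in noncrossing R n ->
  exists2 ts, wmatch (block_of P) 0 ts n & dual_tree R P = PNode ts.
Proof.
move=> Pnc; have partP := noncrossing_partition Pnc.
have [ts Hts] := wmatch_exists (leq0n n) (noncrossing_crossing_free partP Pnc).
by exists ts; last exact: dual_treeE.
Qed.

Lemma dual_tree_trees P : P \in noncrossing R n -> trees n.+1 (dual_tree R P).
Proof.
move=> /noncrossing_match[ts Hts ->].
by rewrite /trees /mkset size_vertices ((match_size _).1 _ _ _ Hts) subn0.
Qed.

(** The common forest determines when two labels share a block, and a partition is recovered from
    this relation. *)
Lemma dual_tree_inj : {in noncrossing R n &, injective (@dual_tree R n)}.
Proof.
move=> P Q Pnc Qnc; have [ts HP ->] := noncrossing_match Pnc.
have [ts' HQ ->] := noncrossing_match Qnc; case=> E; rewrite -{ts'}E in HQ.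
have [_ PQ] := (match_determined _ _).1 _ _ _ HP _ HQ.
rewrite -(finset.preim_partition_pblock (noncrossing_partition Pnc)).
rewrite -(finset.preim_partition_pblock (noncrossing_partition Qnc)).
apply: finset.eq_imset => i; apply/finset.setP => j; rewrite !finset.inE /=.
have := PQ i j (ltn_ord i) (ltn_ord j); rewrite !block_of_ord => H.
by apply/eqP/eqP => /H.
Qed.

(** The blocks are the fibres of an integer labelling that realizes the forest. *)
Lemma dual_tree_surj t : trees n.+1 t -> exists2 P, P \in noncrossing R n & dual_tree R P = t.
Proof.
case: t => ts; rewrite /trees /mkset size_vertices => -[szts].
have [b [f [Hf _]]] := (match_realizable ts).1 0%N.
(* The number of vertices fixes the length of the interval. *)
have ? : b = n by rewrite -szts ((match_size f).1 _ _ _ Hf) subn0.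
subst b; pose P := finset.preim_partition (fun i : 'I_n => f i) [set: 'I_n]%SET.
have partP : finset.partition P [set: 'I_n]%SET by exact: finset.preim_partitionP.
have blockE (i j : 'I_n) : finset.pblock P i = finset.pblock P j <-> f i = f j.
  have eqR : {in [set: 'I_n]%SET & &, equivalence_rel (fun i j : 'I_n => f i == f j)}.
    by split=> // /eqP->.
  have [/eqP cov triv _] := and3P partP.
  have E : (finset.pblock P i == finset.pblock P j) = (f i == f j).
    rewrite finset.eq_pblock ?cov ?finset.inE //.
    exact: (finset.pblock_equivalence_partition eqR (finset.in_setT i) (finset.in_setT j)).
  by split=> /eqP; [rewrite E | rewrite -E] => /eqP.
have HP : wmatch (block_of P) 0 ts n.
  apply: (match_congr _ _).1 Hf _ => u v /andP[_ un] /andP[_ vn].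
  rewrite -[u]/(nat_of_ord (Ordinal un)) -[v]/(nat_of_ord (Ordinal vn)) !block_of_ord.
  by split=> /blockE.
exists P; last exact: dual_treeE.
by apply: crossing_free_noncrossing => //; apply: (match_crossing_free _).1 HP.
Qed.

(** * Weights and partition functions *)

Lemma block_sizeE P (i : 'I_n) : finset.partition P [set: 'I_n]%SET ->
  block_size (block_of P) n i = #|finset.pblock P i|.
Proof.
move=> partP; rewrite /block_size -val_enum_ord count_map cardE /enum_mem size_filter.
rewrite count_filter; apply: eq_count => j /=; rewrite andbT !block_of_ord.
have [/eqP cov triv _] := and3P partP.
by rewrite finset.eq_pblock ?cov.
Qed.

(** Blocks are reindexed by their largest labels, to match [tree_prod_match]. *)
Lemma prod_blocks P (w : nat -> R) : finset.partition P [set: 'I_n]%SET ->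
  \prod_(B in P) w #|B| =
  \prod_(0 <= k < n | block_max (block_of P) n k) w (block_size (block_of P) n k).
Proof.
move=> partP; rewrite big_mkord.
pose A := [set i : 'I_n | block_max (block_of P) n i]%SET.
have PE : P = [set finset.pblock P i | i in A]%SET.
  apply/finset.setP => B; apply/idP/finset.imsetP => [BP|[i _ ->]]; last exact: block_mem.
  have [i iB] := block_nonempty partP BP.
  case: (arg_maxnP (fun i : 'I_n => nat_of_ord i) iB) => m mB m_max.
  exists m; last by rewrite -block_of_ord (block_of_mem partP BP mB).
  rewrite finset.inE; apply/block_maxP => v /andP[mv vn].
  rewrite -[v]/(nat_of_ord (Ordinal vn)) (block_of_mem partP BP mB) block_of_ord => E.
  have /m_max : Ordinal vn \in B by rewrite -E mem_block.
  by rewrite /= leqNgt mv.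
rewrite {1}PE finset.big_imset /=.
  by apply: eq_big => i; rewrite ?finset.inE // block_sizeE.
move=> i j; rewrite !finset.inE => /block_maxP iM /block_maxP jM E.
have [ij|ji|/val_inj //] := ltngtP i j.
- by case: (iM j); rewrite ?ij ?ltn_ord // !block_of_ord E.
- by case: (jM i); rewrite ?ji ?ltn_ord // !block_of_ord E.
Qed.

Lemma weight_treeE (we wo : nat -> R) t :
  weight_tree we wo t = tree_prod (fun black => if black then wo else we) false t.
Proof.
rewrite /weight_tree /tree_prod [RHS](bigID (fun u => ~~ odd (size u))) /=.
congr (_ * _); first by apply: eq_bigr => u /negbTE ->.
by apply: eq_big => u; rewrite ?negbK // => ->.
Qed.

Lemma weight_dual_tree P (w we wo : nat -> R) (c : R) :
  (forall i, wo i = w i.+1) -> (forall i, we i = c ^- i.+1) ->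
  P \in noncrossing R n -> weight_tree we wo (dual_tree R P) = c ^- n.+1 * weight_nc w P.
Proof.
move=> woE weE Pnc; have [ts HP ->] := noncrossing_match Pnc.
rewrite weight_treeE /weight_nc (prod_blocks _ (noncrossing_partition Pnc)) -exprVn.
rewrite -(tree_prod_match c^-1 w HP); apply: eq_bigr => u _ /=.
by case: odd; rewrite ?woE ?weE ?exprVn.
Qed.

(** The trees are the injective image of the partitions under [dual_tree], so the two sums agree
    term by term up to the constant. *)
Lemma partition_fun_treeE (w we wo : nat -> R) (c : R) :
  (forall i, wo i = w i.+1) -> (forall i, we i = c ^- i.+1) ->
  partition_fun_tree we wo n.+1 = c ^- n.+1 * partition_fun_nc w n.
Proof.
move=> woE weE; rewrite /partition_fun_tree /partition_fun_nc.
have -> : trees n.+1 = (@dual_tree R n @` [set` enum (noncrossing R n)])%classic.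
  apply/seteqP; split=> [t /dual_tree_surj[P Pnc <-]|_ [P /= + <-]].
    by exists P; rewrite //= mem_enum.
  by rewrite mem_enum; exact: dual_tree_trees.
rewrite fsbig_image; last first.
  by move=> P Q; rewrite !inE /= !mem_enum; exact: dual_tree_inj.
rewrite -fsbig_seq ?enum_uniq // big_enum mulr_sumr.
by apply: eq_bigr => P Pnc; exact: weight_dual_tree.
Qed.

End DualTree.

Theorem proposition7 (R : realType) (w : nat -> R) (c : R)
    (w_ge0 : forall i, (1 <= i)%N -> 0 <= w i) (c_gt0 : 0 < c)
    (wo we : nat -> R)
    (woE : forall i, wo i = w i.+1) (weE : forall i, we i = c ^- i.+1)
    (n : nat) (n_ge1 : (1 <= n)%N)
    (Z_gt0 : 0 < \sum_(Q in noncrossing R n) weight_nc w Q)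
    (P : {set {set 'I_n}}) (P_nc : P \in noncrossing R n) :
  [/\ trees n.+1 (dual_tree R P),
      0 < partition_fun_tree we wo n.+1 &
      prob_nc w P = prob_tree we wo n.+1 (dual_tree R P)].
Proof.
have cn_gt0 : 0 < c ^- n.+1 by rewrite invr_gt0 exprn_gt0.
split; first exact: dual_tree_trees.
  by rewrite (partition_fun_treeE _ woE weE) mulr_gt0.
rewrite /prob_nc /prob_tree (partition_fun_treeE _ woE weE) (weight_dual_tree woE weE) //.
by rewrite -mulf_div divff ?gt_eqF // mul1r.
Qed.
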